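(* Let $A,B$ be topped PCMs, $\alpha:A\to B$ a morphism with separating relation $\perp_\alpha$, and $R$ a separating relation on $A$. Then the restriction $\alpha/R:A\to B$, defined by $(\alpha/R)(x)=\alpha(x)$ if $x\,R\,\mathbb{1}$ and $(\alpha/R)(x)=\top_B$ otherwise, is a morphism with separating relation $x\perp_{\alpha/R}y:\Leftrightarrow x\perp_\alpha y\wedge x\,R\,y$.
   Context: A topped PCM is a tuple $(A,\bullet,\mathbb{1},\top,D)$ where $\bullet$ is a total commutative associative binary operation on $A$ with unit $\mathbb{1}$, $\top\in A$, and $D\subseteq A$ (the defined elements) satisfy: $\top\notin D$; $\mathbb{1}\in D$; if $x\bullet y\in D$ then $x,y\in D$; $x\bullet\top=\top\bullet x=\top$. Write $x\perp y$ for $x\bullet y\in D$. A relation $R$ on $A$ is a separating relation if: (1) $x\,R\,y$ implies $x\,R\,\mathbb{1}$; (2) $x\,R\,y$ implies $x\perp y$; (3) $\mathbb{1}\,R\,\mathbb{1}$; (4) $x\,R\,y$ iff $y\,R\,x$; (5) $x\,R\,y$ and $(x\bullet y)\,R\,z$ imply $x\,R\,(y\bullet z)$ and $y\,R\,z$. A morphism $\phi:A\to B$ of topped PCMs with separating relation $\perp_\phi$ on $A$ is a function such that $\phi(\mathbb{1}_A)=\mathbb{1}_B$, $\phi(\top_A)=\top_B$, and $x\perp_\phi y$ implies $\phi(x)\perp\phi(y)$ and $\phi(x\bullet y)=\phi(x)\bullet\phi(y)$. (So asserting that something is a morphism with a given relation includes that the relation is a separating relation.) *)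

(* Defs.v *)
From Stdlib Require Import Relation_Definitions ClassicalEpsilon.

Record toppedPCM : Type := ToppedPCM {
  carrier :> Type;
  op : carrier -> carrier -> carrier;
  unit_el : carrier;
  top_el : carrier;
  defined : carrier -> Prop;
  op_comm : forall x y, op x y = op y x;
  op_assoc : forall x y z, op x (op y z) = op (op x y) z;
  op_unit : forall x, op unit_el x = x;
  top_undefined : ~ defined top_el;
  unit_defined : defined unit_el;
  defined_op : forall x y, defined (op x y) -> defined x /\ defined y;
  op_top : forall x, op x top_el = top_el
}.

Arguments op {t} x y.
Arguments unit_el {t}.
Arguments top_el {t}.
Arguments defined {t} x.

Declare Scope pcm_scope.
Delimit Scope pcm_scope with pcm.
Notation "x • y" := (op x y) (at level 40, left associativity) : pcm_scope.
Notation "𝟙" := unit_el : pcm_scope.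
Notation "⊤" := top_el : pcm_scope.
Open Scope pcm_scope.

Definition disjoint {A : toppedPCM} (x y : A) : Prop := defined (x • y).
Notation "x ⊥ y" := (disjoint x y) (at level 70, no associativity) : pcm_scope.

Record separating {A : toppedPCM} (R : relation A) : Prop := Separating {
  sep_unit_r : forall x y, R x y -> R x 𝟙;
  sep_disjoint : forall x y, R x y -> x ⊥ y;
  sep_unit : R 𝟙 𝟙;
  sep_sym : forall x y, R x y <-> R y x;
  sep_assoc : forall x y z, R x y -> R (x • y) z -> R x (y • z) /\ R y z
}.

Record morphism {A B : toppedPCM} (phi : A -> B) (R : relation A) : Prop :=
Morphism {
  morph_separating : separating R;
  morph_unit : phi 𝟙 = 𝟙;
  morph_top : phi ⊤ = ⊤;
  morph_op : forall x y, R x y ->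
    phi x ⊥ phi y /\ phi (x • y) = phi x • phi y
}.

(* [R] is an arbitrary relation, so the case split on [R x 𝟙] is classical. *)
Definition restriction {A B : toppedPCM} (alpha : A -> B) (R : relation A) :
    A -> B :=
  fun x => if excluded_middle_informative (R x 𝟙) then alpha x else ⊤.

Definition restriction_sep {A : toppedPCM} (sep_alpha R : relation A) :
    relation A :=
  fun x y => sep_alpha x y /\ R x y.

(* Main.v *)
Require Import Defs.
From Stdlib Require Import Relation_Definitions ClassicalEpsilon.

(** If [R x y] holds, then [x], [y] and [x • y] are all [R]-related to [𝟙], so the restriction
    agrees with [alpha] at all three and the morphism law of [alpha] carries over. The case of
    [x • y] is [separating_unit_op]. That the new relation is separating is
    [separating_restriction]. *)

(** This is the associativity axiom at the triple [𝟙], [x], [y], since [𝟙 • x = x]. *)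
Lemma separating_unit_op {A : toppedPCM} (R : relation A) (x y : A) :
  separating R -> R x y -> R (x • y) 𝟙.
Proof.
  intros HR Hxy.
  apply (sep_sym R HR).
  apply (sep_assoc R HR 𝟙 x y).
  - apply (sep_sym R HR). exact (sep_unit_r R HR x y Hxy).
  - rewrite op_unit. exact Hxy.
Qed.

Lemma separating_top {A : toppedPCM} (R : relation A) (x : A) :
  separating R -> ~ R ⊤ x.
Proof.
  intros HR H. apply (top_undefined A).
  apply (defined_op A ⊤ x). exact (sep_disjoint R HR _ _ H).
Qed.

Lemma restriction_in {A B : toppedPCM} (alpha : A -> B) (R : relation A)
    (x : A) :
  R x 𝟙 -> restriction alpha R x = alpha x.
Proof.
  intros Hx. unfold restriction.
  destruct (excluded_middle_informative (R x 𝟙)); [reflexivity | contradiction].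
Qed.

Lemma restriction_out {A B : toppedPCM} (alpha : A -> B) (R : relation A)
    (x : A) :
  ~ R x 𝟙 -> restriction alpha R x = ⊤.
Proof.
  intros Hx. unfold restriction.
  destruct (excluded_middle_informative (R x 𝟙)); [contradiction | reflexivity].
Qed.

(** Each axiom derives [R]-facts or definedness from [R]-facts, so it passes to the intersection
    componentwise. *)
Lemma separating_restriction {A : toppedPCM} (S R : relation A) :
  separating S -> separating R -> separating (restriction_sep S R).
Proof.
  intros HS HR. split; unfold restriction_sep.
  - intros x y [H1 H2]. split; eapply sep_unit_r; eassumption.
  - intros x y [H1 _]. exact (sep_disjoint S HS x y H1).
  - split; apply sep_unit; assumption.
  - intros x y. rewrite (sep_sym S HS x y), (sep_sym R HR x y). reflexivity.
  - intros x y z [H1 H2] [H3 H4].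
    destruct (sep_assoc S HS x y z H1 H3), (sep_assoc R HR x y z H2 H4).
    auto.
Qed.

Theorem mainTheorem4 (A B : toppedPCM) (alpha : A -> B)
    (sep_alpha : relation A) (R : relation A)
    (Halpha : morphism alpha sep_alpha) (HR : separating R) :
  morphism (restriction alpha R) (restriction_sep sep_alpha R).
Proof.
  destruct Halpha as [Hsep Hunit _ Hop]. split.
  - exact (separating_restriction sep_alpha R Hsep HR).
  - rewrite restriction_in; [exact Hunit | exact (sep_unit R HR)].
  (* [⊤] is never [R]-related to [𝟙], so it falls into the default branch, whose value is [⊤]. *)
  - apply restriction_out. exact (separating_top R 𝟙 HR).
  - intros x y [Ha HRxy].
    (* The side conditions place [x • y], [y] and [x] in the region where the restriction equals
       [alpha]. *)
    rewrite !restriction_in.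
    + exact (Hop x y Ha).
    + exact (separating_unit_op R x y HR HRxy).
    + apply (sep_unit_r R HR y x), (sep_sym R HR), HRxy.
    + exact (sep_unit_r R HR x y HRxy).
Qed.
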